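(* Let $L>0$, $\Omega=(0,L)$ and $\delta>0$. Then for any $\varepsilon>0$ there exists $C(\varepsilon,\delta)>0$ such that for all $u\in H^1(\Omega)$, $$\int_\Omega|u|^4\,dx\le\varepsilon\,\|u\|_{\mathsf{M}^{1,\delta}(\Omega)}^2\,\|\partial_x u\|_{L^2(\Omega)}^2+C(\varepsilon,\delta)\,\|u\|_{L^1(\Omega)}^4 .$$
   Context: For $\delta>0$ the Morrey norm is $\|f\|_{\mathsf{M}^{1,\delta}(\Omega)}:=\sup_{0<\varepsilon<L}\ \sup_{x_0\in\Omega}\varepsilon^{-\delta}\|f\|_{L^1([x_0-\varepsilon,x_0+\varepsilon]\cap\Omega)}$. The constant $C(\varepsilon,\delta)$ may depend on the fixed $L$ but not on $u$. *)

(* Defs.v *)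
From mathcomp Require Import all_boot all_order all_algebra.
From mathcomp Require Import all_classical all_reals all_analysis.

Set Implicit Arguments.
Unset Strict Implicit.
Unset Printing Implicit Defensive.
Import Order.TTheory GRing.Theory Num.Theory.
Import numFieldNormedType.Exports.

Local Open Scope ring_scope.
Local Open Scope classical_set_scope.

(* C_c^oo(Omega), each test function being extended by 0 to the whole line. *)
Definition test_function (R : realType) (Omega : set R) (phi : R -> R) : Prop :=
  (forall (n : nat) (x : R), derivable (phi^`(n)) x 1) /\
  (exists K : set R, [/\ compact K, K `<=` Omega &
     forall x : R, ~ K x -> phi x = 0]).

(* Both integrands are integrable, u and g being locally integrable and phi
   compactly supported, so the junk values of Rintegral play no role. *)
Definition weak_derivative (R : realType) (Omega : set R) (u g : R -> R) : Prop :=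
  [/\ locally_integrable Omega u, locally_integrable Omega g &
   forall phi : R -> R, test_function Omega phi ->
     (\int[@lebesgue_measure R]_(x in Omega) (u x * (phi^`())%classic x)
      = - \int[@lebesgue_measure R]_(x in Omega) (g x * phi x))%R].

(* The L^p norm of u over A: u \_ A is u on A and 0 outside A. *)
Definition Lnorm_on (R : realType) (p : R) (A : set R) (u : R -> R) : \bar R :=
  'N[@lebesgue_measure R]_(p%:E)[EFin \o (u \_ A)]%E.

Definition L2 (R : realType) (Omega : set R) (u : R -> R) : Prop :=
  measurable_fun Omega u /\ (Lnorm_on 2 Omega u < +oo)%E.

Definition H1 (R : realType) (Omega : set R) (u : R -> R) : Prop :=
  L2 Omega u /\ (exists g : R -> R, weak_derivative Omega u g /\ L2 Omega g).

(* The norm of M^{1,delta}(Omega) for Omega = (0, L); it may be +oo. *)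
Definition morrey_norm (R : realType) (L delta : R) (u : R -> R) : \bar R :=
  ereal_sup [set ereal_sup
    [set ((e `^ (- delta))%:E *
          Lnorm_on 1 (`[(x0 - e)%R, (x0 + e)%R] `&` `]0%R, L[) u)%E
    | x0 in `]0%R, L[%classic]
  | e in `]0%R, L[%classic].

(* Main.v *)
(* On an interval I of length h contained in (0, L), put m = int_I |u| and
   D = int_I g^2, where g is a weak derivative of u. Testing the weak derivative
   against smoothed indicators of [a, b] and letting the smoothing shrink gives
   |u a - u b| <= int_J |g| for Lebesgue points a, b of u in an open J. Averaging
   in b over J of length l <= h, and bounding int_J |g| by AM-GM,
   |u a| <= m / l + (t D + l / t) / 2 for all t > 0. If |u a| > 2 m / h, the
   choice l = 2 m / |u a| is allowed; in all cases this yields the local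
   Gagliardo-Nirenberg bound |u a|^3 <= 8 m D + 8 (m / h)^3, hence
   int_I |u|^4 <= 8 m^2 D + 8 m^4 / h^3. Now cut (0, L) into n intervals of
   length h = L / n: each m is at most (h / 2)^delta times the Morrey norm, so
   that n large makes 8 (h / 2)^(2 delta) <= eps, and C = 8 n / h^3. *)
Require Import Defs.
From mathcomp Require Import all_boot all_order all_algebra.
From mathcomp Require Import all_classical all_reals all_analysis.
From mathcomp Require Import measurable_realfun ring lra.
Import Order.TTheory GRing.Theory Num.Theory.
Import numFieldNormedType.Exports.
Local Open Scope classical_set_scope.
Local Open Scope ring_scope.

(** * A smooth step function *)

Section smooth_step.
Context {R : realType}.
Implicit Types (x t : R) (n : nat).

(** The powers of [t^-1] are carried along so that every derivative of [exp (- 1 / t)], extended by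
    0 to [t <= 0], is a constant-coefficient combination of members of the family. *)
Definition flat n t : R := if 0 < t then t^-1 ^+ n * expR (- t^-1) else 0.

Lemma flat_ge0 n t : 0 <= flat n t.
Proof.
rewrite /flat; case: ifP => // t0.
by rewrite mulr_ge0 ?expR_ge0// exprn_ge0// invr_ge0 ltW.
Qed.

Lemma flat_gt0 n t : 0 < t -> 0 < flat n t.
Proof. by move=> t0; rewrite /flat t0 mulr_gt0 ?expR_gt0// exprn_gt0// invr_gt0. Qed.

Lemma flat_le0 n t : t <= 0 -> flat n t = 0.
Proof. by rewrite /flat leNgt; case: (0 < t). Qed.

(** With [s = 1 / t], the exponential series gives [exp s >= s^(n+1) / (n+1)!], so [s^n exp (- s)]
    is at most [(n+1)! / s]. This linear decay at 0 is what differentiability there requires. *)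
Lemma flat_le n t : flat n t <= n.+1`!%:R * `|t|.
Proof.
have [t0|t0] := ltP 0 t; last by rewrite flat_le0// mulr_ge0.
rewrite /flat t0 expRN gtr0_norm//.
have s0 : 0 < t^-1 by rewrite invr_gt0.
have h := expR_ge1Dxn n (ltW s0).
rewrite ler_pdivrMr ?expR_gt0//.
have {}h : t^-1 ^+ n.+1 / n.+1`!%:R <= expR t^-1 by apply: le_trans h; rewrite lerDr.
rewrite ler_pdivrMr ?ltr0n ?fact_gt0// in h.
apply: (@le_trans _ _ (t * (t^-1 ^+ n.+1))); last first.
  by rewrite [leRHS]mulrAC [leRHS]mulrC ler_pM2l// mulrC.
by rewrite exprS mulrA divff ?gt_eqF// mul1r.
Qed.

Lemma flat_mulV n t : t^-1 * flat n t = flat n.+1 t.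
Proof. by rewrite /flat; case: ifP => _; rewrite ?mulr0// exprS mulrA. Qed.

Lemma is_derive_flat n x :
  is_derive x 1 (flat n) (flat n.+2 x - n%:R * flat n.+1 x).
Proof.
have [x0|x0|->] := ltgtP x 0.
- apply: (@near_eq_is_derive _ R R (cst 0)) => //.
  + near=> y; rewrite flat_le0// ltW//.
    by near: y; apply: lt_nbhsl.
  + rewrite !flat_le0 ?(ltW x0)// mulr0 subrr; exact: is_derive_cst.
- pose V := fun t : R => t^-1.
  have xn0 : x != 0 by rewrite gt_eqF.
  have dV : is_derive x 1 V (- x ^- 2 *: 1) := is_deriveV xn0 (is_derive_id x 1).
  apply: (@near_eq_is_derive _ R R (V ^+ n * (expR \o (- V)))).
  + near=> y; rewrite /flat ifT//; first by rewrite !fctE.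
    by near: y; apply: lt_nbhsr.
  + apply: is_derive_eq.
    rewrite /flat x0 /= !fctE /V /GRing.scale/= mulr1.
    case: n => [|n]; rewrite ?expr0 /= ?exprS; field; exact: xn0.
(* The difference quotient of [flat n] at 0 is [flat n.+1] itself, which tends to 0 by the linear
   bound. *)
- have q0 : h^-1 *: ((flat n \o shift 0) (h *: 1) - flat n 0) @[h --> 0^'] --> (0:R).
    under eq_fun do rewrite /= addr0 (flat_le0 _ _ (lexx 0)) subr0 /GRing.scale/= mulr1 flat_mulV.
    apply/cvgr0Pnorm_lt => e e0.
    have C0 : 0 < n.+2`!%:R :> R by rewrite ltr0n fact_gt0.
    near=> y; rewrite ger0_norm ?flat_ge0//.
    apply: le_lt_trans (flat_le _ _) _.
    rewrite mulrC -ltr_pdivlMr//.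
    near: y.
    apply: dnbhs0_lt; by rewrite divr_gt0.
  rewrite !flat_le0// mulr0 subrr.
  apply: DeriveDef; first by apply/cvg_ex; exists 0.
  exact/cvg_lim.
Unshelve. all: by end_near. Qed.

Lemma flat_norm_gt0 x : 0 < flat 0 x + flat 0 (1 - x).
Proof.
have [x0|x0] := ltP 0 x.
  by rewrite ltr_wpDr ?flat_ge0// flat_gt0.
by rewrite ltr_wpDl ?flat_ge0// flat_gt0// subr_gt0 (le_lt_trans x0).
Qed.

(* Contains the smooth step and is stable under derivation, so that all its
   members are smooth. *)
Inductive flat_algebra : (R -> R) -> Prop :=
| flat_algebra_cst c : flat_algebra (cst c)
| flat_algebra_flat n : flat_algebra (flat n)
| flat_algebra_inv : flat_algebra (fun x => (flat 0 x + flat 0 (1 - x))^-1)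
| flat_algebra_add f g : flat_algebra f -> flat_algebra g -> flat_algebra (f + g)
| flat_algebra_mul f g : flat_algebra f -> flat_algebra g -> flat_algebra (f * g)
| flat_algebra_affine a b f : flat_algebra f -> flat_algebra (fun x => f (a * x + b)).

Lemma is_derive_affine (f : R -> R) a b x d : is_derive (a * x + b) 1 f d ->
  is_derive x 1 (fun x => f (a * x + b)) (a * d).
Proof.
move=> fd.
have ad : is_derive x 1 (fun x : R => a * x + b) a.
  have -> : (fun x : R => a * x + b) = a *: id + cst b by apply/funext.
  by apply: is_derive_eq; rewrite addr0 /GRing.scale/= mulr1.
rewrite mulrC; exact: (@is_derive1_comp R f (fun x => a * x + b) x d a fd ad).
Qed.

(** Induction on the generators. The only nonlinear one is the reciprocal [S]: its derivative is
    [- S^2] times [flat 2 x - flat 2 (1 - x)], again built from generators. *)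
Lemma flat_algebra_derive f : flat_algebra f ->
  exists2 f', flat_algebra f' & forall x, is_derive x 1 f (f' x).
Proof.
elim=> {f}.
- by move=> c; exists (cst 0); [exact: flat_algebra_cst|move=> x; exact: is_derive_cst].
- move=> n; exists (flat n.+2 + cst (- n%:R) * flat n.+1).
    apply: flat_algebra_add; first exact: flat_algebra_flat.
    by apply: flat_algebra_mul; [exact: flat_algebra_cst|exact: flat_algebra_flat].
  move=> x; apply: is_derive_eq; first exact: is_derive_flat.
  by rewrite !fctE mulNr.
- pose S := (fun x => (flat 0 x + flat 0 (1 - x))^-1).
  pose d := flat 2 + cst (- 1) * (fun x => flat 2 ((- 1) * x + 1)).
  have Sa : flat_algebra S := flat_algebra_inv.
  exists (cst (- 1) * (S * S) * d).
    apply: flat_algebra_mul.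
      by apply: flat_algebra_mul; [exact: flat_algebra_cst|exact: flat_algebra_mul].
    apply: flat_algebra_add; first exact: flat_algebra_flat.
    apply: flat_algebra_mul; first exact: flat_algebra_cst.
    by apply: flat_algebra_affine; exact: flat_algebra_flat.
  move=> x.
  have dd : is_derive x 1 (flat 0 + (fun x => flat 0 ((- 1) * x + 1))) (d x).
    apply: is_deriveD.
      by apply: (is_derive_eq (is_derive_flat _ _)); rewrite mul0r subr0.
    apply: is_derive_affine.
    by apply: (is_derive_eq (is_derive_flat _ _)); rewrite mul0r subr0.
  have -> : (fun x => (flat 0 x + flat 0 (1 - x))^-1) =
     (fun x => ((flat 0 + (fun x => flat 0 ((- 1) * x + 1))) x)^-1).
    apply/funext => y; rewrite !fctE mulN1r. by rewrite (addrC 1).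
  apply: is_derive_eq.
    apply: is_deriveV dd; rewrite !fctE mulN1r (addrC (- x)) gt_eqF//.
    exact: flat_norm_gt0.
  by rewrite /S !fctE mulN1r (addrC (- x)) /GRing.scale/= mulN1r expr2 invfM.
- move=> f g fa [f' fa' df] ga [g' ga' dg]; exists (f' + g').
    exact: flat_algebra_add.
  by move=> x; rewrite !fctE; exact: is_deriveD.
- move=> f g fa [f' fa' df] ga [g' ga' dg]; exists (f * g' + g * f').
    by apply: flat_algebra_add; apply: flat_algebra_mul.
  by move=> x; rewrite !fctE; exact: is_deriveM.
- move=> a b f fa [f' fa' df]; exists (cst a * (fun x => f' (a * x + b))).
    by apply: flat_algebra_mul; [exact: flat_algebra_cst|exact: flat_algebra_affine].
  by move=> x; rewrite !fctE; exact: is_derive_affine.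
Qed.

Lemma flat_algebra_derive1 f : flat_algebra f ->
  flat_algebra (f^`())%classic /\ forall x, derivable f x 1.
Proof.
move=> /flat_algebra_derive[f' f'a df].
have -> : f^`()%classic = f' by apply/funext => x; rewrite derive1E derive_val.
by split=> // x; apply: ex_derive; exact: df.
Qed.

Lemma flat_algebra_smooth f n x : flat_algebra f -> derivable (f^`(n))%classic x 1.
Proof.
elim: n f => [|n ih] f fa; first exact: (flat_algebra_derive1 _ fa).2.
by rewrite derive1Sn; apply: ih; exact: (flat_algebra_derive1 _ fa).1.
Qed.

Lemma flat_algebra_continuous f : flat_algebra f -> continuous f.
Proof.
move=> fa x; apply: differentiable_continuous; apply/derivable1_diffP.
exact: (flat_algebra_derive1 _ fa).2.
Qed.

Definition step x := flat 0 x * (flat 0 x + flat 0 (1 - x))^-1.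

Lemma flat_algebra_step : flat_algebra step.
Proof.
have -> : step = flat 0 * (fun x => (flat 0 x + flat 0 (1 - x))^-1) by apply/funext.
by apply: flat_algebra_mul; [exact: flat_algebra_flat|exact: flat_algebra_inv].
Qed.

Lemma step_le0 x : x <= 0 -> step x = 0.
Proof. by move=> x0; rewrite /step flat_le0// mul0r. Qed.

Lemma step_ge1 x : 1 <= x -> step x = 1.
Proof.
move=> x1; rewrite /step [flat 0 (1 - x)]flat_le0 ?subr_le0// addr0 divff// gt_eqF//.
by rewrite flat_gt0// (lt_le_trans ltr01).
Qed.

Lemma step_ge0 x : 0 <= step x.
Proof. by rewrite /step divr_ge0 ?flat_ge0// ltW ?flat_norm_gt0. Qed.

Lemma step_le1 x : step x <= 1.
Proof. by rewrite /step ler_pdivrMr ?flat_norm_gt0// mul1r lerDl flat_ge0. Qed.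

Lemma step'_out x : x \notin `[0, 1]%R -> (step^`())%classic x = 0.
Proof.
move=> x01; rewrite derive1E.
have [x0|x0] := ltP x 0.
  apply: (@derive_val _ _ _ _ _ _ _).
  apply: (@near_eq_is_derive _ R R (cst 0)).
  near=> y; rewrite step_le0// ltW//; near: y; exact: lt_nbhsl.
have x1 : 1 < x by rewrite ltNge; apply: contra x01 => x1; rewrite in_itv/= x0.
apply: (@derive_val _ _ _ _ _ _ _).
apply: (@near_eq_is_derive _ R R (cst 1)).
near=> y; rewrite step_ge1// ltW//; near: y; exact: lt_nbhsr.
Unshelve. all: by end_near. Qed.

(** The derivative is continuous, hence bounded on [[0, 1]], and it vanishes elsewhere because
    [step] is locally constant there. *)
Lemma step'_bounded : exists2 K : R, 0 < K & forall x, `|(step^`())%classic x| <= K.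
Proof.
have cs := flat_algebra_continuous _ (flat_algebra_derive1 _ flat_algebra_step).1.
have [c _ hc] := @EVT_max R (fun x => `|(step^`())%classic x|) 0 1 ler01
  (continuous_subspaceT (fun x => continuous_comp (cs x) (@norm_continuous _ _ _))).
exists (`|(step^`())%classic c| + 1); first by rewrite ltr_wpDl.
move=> x; have [x01|x01] := boolP (x \in `[0, 1]%R).
  by apply: (le_trans (hc _ x01)); rewrite lerDl.
by rewrite step'_out// normr0 addr_ge0.
Qed.

End smooth_step.

(** * Mollification at a Lebesgue point *)

Section mollification.
Context {R : realType}.
Implicit Types (a b e x : R) (f : R -> R).
Local Notation mu := (@lebesgue_measure R).

Definition step_at a e x : R := step (e^-1 * (x - a)).

(** The derivative of [step_at a e]: a one-sided kernel of mass 1 carried by [[a, a + e]], with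
    height of order [1 / e]. *)
Definition mollifier a e x : R := e^-1 * (step^`())%classic (e^-1 * (x - a)).

Lemma flat_algebra_step_at a e : flat_algebra (step_at a e).
Proof.
have -> : step_at a e = (fun x => step (e^-1 * x + (- (e^-1 * a)))).
  by apply/funext => x; rewrite /step_at mulrBr.
exact: flat_algebra_affine flat_algebra_step.
Qed.

Lemma is_derive_step_at a e x : is_derive x 1 (step_at a e) (mollifier a e x).
Proof.
have -> : step_at a e = (fun x => step (e^-1 * x + (- (e^-1 * a)))).
  by apply/funext => y; rewrite /step_at mulrBr.
rewrite /mollifier mulrBr; apply: is_derive_affine.
rewrite derive1E; apply/derivableP.
exact: (flat_algebra_derive1 _ flat_algebra_step).2.
Qed.

Lemma derive1_step_at a e : ((step_at a e)^`())%classic = mollifier a e.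
Proof.
by apply/funext => x; rewrite derive1E; have [] := is_derive_step_at a e x.
Qed.

Lemma mollifier_continuous a e : continuous (mollifier a e).
Proof.
rewrite -derive1_step_at; apply: flat_algebra_continuous.
exact: (flat_algebra_derive1 _ (flat_algebra_step_at a e)).1.
Qed.

Lemma measurable_mollifier a e D : measurable D -> measurable_fun D (mollifier a e).
Proof.
move=> mD; apply: (measurable_funS measurableT) => //.
apply: continuous_measurable_fun; exact: mollifier_continuous.
Qed.

Lemma mollifier_out a e x : 0 < e -> x \notin `[a, a + e] -> mollifier a e x = 0.
Proof.
move=> e0 xae; rewrite /mollifier step'_out ?mulr0//.
apply: contra xae; rewrite !in_itv/= mulrC => /andP[].
by rewrite pmulr_lge0 ?invr_gt0// subr_ge0 ler_pdivrMr// mul1r lerBlDl => -> ->.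
Qed.

Lemma integral_mollifier a e : 0 < e ->
  \int[mu]_(x in `[a, a + e]) mollifier a e x = 1.
Proof.
move=> e0; rewrite /Rintegral (@continuous_FTC2 _ _ (step_at a e)) ?ltrDl//.
- rewrite /step_at (addrC a) addrK mulVf ?gt_eqF// subrr mulr0.
  by rewrite step_ge1// step_le0//= subr0.
- exact/continuous_subspaceT/mollifier_continuous.
- have ch := flat_algebra_continuous _ (flat_algebra_step_at a e).
  split => [x _||].
  + exact: (flat_algebra_derive1 _ (flat_algebra_step_at a e)).2.
  + exact/cvg_at_right_filter/ch.
  + exact/cvg_at_left_filter/ch.
- by move=> x _; rewrite derive1_step_at.
Qed.

Lemma integrable_mulr_mollifier f a e D : 0 < e -> measurable D ->
  mu.-integrable D (EFin \o f) ->
  mu.-integrable D (fun x => (f x * mollifier a e x)%:E).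
Proof.
move=> e0 mD fi.
apply: (@eq_integrable _ _ _ _ _ mD ((EFin \o f) \* (EFin \o mollifier a e))%E) => //.
apply: integrableMl => //; first exact: measurable_mollifier.
have [K K0 hK] := @step'_bounded R.
exists (e^-1 * K); split; first exact: num_real.
move=> z /ltW zM x _ /=; apply: le_trans zM.
by rewrite /mollifier normrM ger0_norm ?invr_ge0 ?(ltW e0)// ler_pM2l ?invr_gt0.
Qed.

Lemma integrable_cst_fin (A : set R) (r : R) : measurable A -> (mu A < +oo)%E ->
  mu.-integrable A (EFin \o cst r).
Proof.
move=> mA Aoo; apply: measurable_bounded_integrable => //.
by exists `|r|; split; [exact: num_real|move=> z /ltW zM x _].
Qed.

(** As the kernel has mass 1, the error is the integral of [f - f a] against it. Bounding the kernel
    by a constant over [e] turns this into a mean oscillation of [f] around [a]. *)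
Lemma mollify_le : exists2 K : R, 0 < K & forall f a e, 0 < e ->
  mu.-integrable setT (EFin \o f) ->
  (`|\int[mu]_x (f x * mollifier a e x) - f a|%:E <= K%:E * davg f a (2 * e))%E.
Proof.
have [K K0 hK] := @step'_bounded R.
(* The kernel is at most [K / e] and the ball of radius [2 e] has measure [4 e]. *)
exists (4 * K); first by rewrite mulr_gt0.
move=> f a e e0 fi.
have mf : measurable_fun setT f by apply/measurable_EFinP; case/integrableP: fi.
pose B := [set` `[a, a + e]].
have mB : measurable B by exact: measurable_itv.
have fB : mu.-integrable B (EFin \o f) by exact: integrableS fi.
have Boo : (mu B < +oo)%E.
  by rewrite lebesgue_measure_itv/=; case: ifPn; rewrite ?ltry// -EFinB ltry.
have kB : mu.-integrable B (EFin \o mollifier a e).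
  apply: continuous_compact_integrable; first exact: segment_compact.
  exact/continuous_subspaceT/mollifier_continuous.
have -> : \int[mu]_x (f x * mollifier a e x) - f a =
    \int[mu]_(x in B) ((f x - f a) * mollifier a e x).
  under [in RHS]eq_Rintegral do rewrite mulrBl.
  rewrite RintegralB//=; [|exact: integrable_mulr_mollifier|]; last first.
    exact: (@integrableZl _ _ _ mu B mB (f a) _ kB).
  rewrite RintegralZl// integral_mollifier// mulr1; congr (_ - _).
  rewrite [RHS]Rintegral_mkcond; apply: eq_Rintegral => x _.
  rewrite patchE; case: ifPn => // xB; rewrite mollifier_out ?mulr0//.
  by apply: contra xB => xB; rewrite inE.
have ii : mu.-integrable B (EFin \o (fun x => (f x - f a) * mollifier a e x)).
  apply: (@integrable_mulr_mollifier (fun x => f x - f a)) => //.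
  have cB := integrable_cst_fin _ (f a) mB Boo.
  exact: (@integrableB _ _ _ mu B mB _ _ fB cB).
rewrite EFin_normr_Rintegral//.
apply: (le_trans (le_abse_integral _ _ _)) => //; first by case/integrableP: ii.
(* Balls are open: radius [e] would miss the endpoint [a + e], whereas radius [2 e] covers the whole
   support. *)
have e2 : 0 < 2 * e by rewrite mulr_gt0.
have bE : (\int[mu]_(x in ball a (2 * e)) `|(f x - f a)%:E| =
    (4 * e)%:E * davg f a (2 * e))%E.
  have -> : 4 * e = (2 * e) *+ 2 by rewrite -mulr_natr; ring.
  rewrite /davg /iavg lebesgue_measure_ball ?(ltW e2)// muleA.
  by rewrite inver mulrn_eq0/= gt_eqF// -EFinM divff ?mul1e// mulrn_eq0/= gt_eqF.
have -> : ((4 * K)%:E = (K / e)%:E * (4 * e)%:E)%E.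
  by rewrite -EFinM; congr EFin; field; rewrite gt_eqF.
rewrite -muleA -bE.
have mfa D : measurable D -> measurable_fun D (fun x => `|(f x - f a)%:E|)%E.
  move=> mD; apply: measurableT_comp => //; apply/measurable_EFinP.
  by apply: measurable_funB => //; exact: measurable_funS mf.
have Ke0 : 0 <= K / e by rewrite divr_ge0 ?ltW.
apply: (@le_trans _ _ (\int[mu]_(x in B) ((K / e)%:E * `|(f x - f a)%:E|))%E).
  apply: ge0_le_integral => //.
  - by case/integrableP: ii => m _; exact: measurableT_comp.
  - by apply: measurable_funeM; exact: mfa.
  - move=> x _; rewrite -EFinM lee_fin normrM mulrC ler_wpM2r//.
    by rewrite /mollifier normrM ger0_norm ?invr_ge0 ?(ltW e0)// mulrC ler_wpM2r// invr_ge0 ltW.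
rewrite -ge0_integralZl//; [|exact: measurable_ball|by apply: mfa; exact: measurable_ball].
apply: ge0_subset_integral => //.
- exact: measurable_ball.
- by apply: measurable_funeM; apply: mfa; exact: measurable_ball.
- by move=> x _; rewrite mule_ge0.
move=> x; rewrite /B/= in_itv/= => /andP[ax xe].
rewrite /ball/= distrC ger0_norm ?subr_ge0// ltrBlDl (le_lt_trans xe)// ltrD2l.
by rewrite ltr_pMl// ltr1n.
Qed.

End mollification.

(** * Oscillation of a weakly differentiable function *)

Section weak_derivative_oscillation.
Context {R : realType}.
Implicit Types (a b c d : R) (u g : R -> R) (Omega : set R).
Local Notation mu := (@lebesgue_measure R).

Lemma lebesgue_pt_mollify (f : R -> R) a (eta : R) : mu.-integrable setT (EFin \o f) ->
  lebesgue_pt f a -> 0 < eta ->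
  \forall e \near 0^'+, `|\int[mu]_x (f x * mollifier a e x) - f a| <= eta.
Proof.
move=> fi fa eta0; have [K K0 hK] := @mollify_le R.
have eK : 0 < eta / K by rewrite divr_gt0.
have : \forall r \near (0:R)^'+, (davg f a r < (eta / K)%:E)%E.
  have h : nbhs (0%E : \bar R) [set y | (y < (eta / K)%:E)%E].
    by apply: open_ereal_lt'; rewrite lte_fin.
  exact: (fa _ h).
move=> [r /= r0 hr].
(* The average is taken at radius [2 e], so [e] has to stay below [r / 2]. *)
have r20 : 0 < r / 2 by rewrite divr_gt0.
near=> e.
have e0 : 0 < e by near: e; exact: nbhs_right_gt.
rewrite -lee_fin (le_trans (hK f a e e0 fi))//.
have -> : eta%:E = (K%:E * (eta / K)%:E)%E.
  by rewrite -EFinM; congr EFin; field; rewrite gt_eqF.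
rewrite lee_pmul2l//; apply: ltW; apply: hr => /=; last by rewrite mulr_gt0.
rewrite sub0r normrN gtr0_norm ?mulr_gt0// mulrC -ltr_pdivlMr//.
Unshelve. all: by end_near. Qed.

(** A smoothed indicator of [[a, b]] whose derivative is the difference of the mollifiers at [a] and
    at [b]. *)
Definition plateau a b e : R -> R := step_at a e - step_at b e.

Lemma flat_algebra_plateau a b e : flat_algebra (plateau a b e).
Proof.
have -> : plateau a b e = step_at a e + cst (- 1) * step_at b e.
  by apply/funext => x; rewrite /plateau !fctE mulN1r.
apply: flat_algebra_add; first exact: flat_algebra_step_at.
by apply: flat_algebra_mul; [exact: flat_algebra_cst|exact: flat_algebra_step_at].
Qed.

Lemma derive1_plateau a b e :
  ((plateau a b e)^`())%classic = mollifier a e - mollifier b e.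
Proof.
apply/funext => x; rewrite derive1E.
have da := is_derive_step_at a e x; have db := is_derive_step_at b e x.
by rewrite /plateau; apply: derive_val.
Qed.

Lemma plateau_le1 a b e x : `|plateau a b e x| <= 1.
Proof.
rewrite /plateau !fctE /step_at.
have := step_ge0 (e^-1 * (x - a)); have := step_le1 (e^-1 * (x - a)).
have := step_ge0 (e^-1 * (x - b)); have := step_le1 (e^-1 * (x - b)).
by rewrite ler_norml => ? ? ? ?; apply/andP; split; lra.
Qed.

Lemma plateau_out a b e x : 0 < e -> a <= b -> x \notin `[a, b + e] ->
  plateau a b e x = 0.
Proof.
move=> e0 ab; rewrite in_itv/= negb_and -!ltNge /plateau !fctE /step_at.
have ei : 0 < e^-1 by rewrite invr_gt0.
move=> /orP[xa|bx].
  by rewrite !step_le0 ?subrr// pmulr_rle0// subr_le0 ltW// (lt_le_trans xa).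
by rewrite !step_ge1 ?subrr// mulrC ler_pdivlMr// mul1r; lra.
Qed.

Lemma test_function_plateau Omega a b e : 0 < e -> a <= b ->
  `[a, b + e]%classic `<=` Omega -> test_function Omega (plateau a b e).
Proof.
move=> e0 ab abO; split; first by move=> n x; apply/flat_algebra_smooth/flat_algebra_plateau.
exists `[a, b + e]%classic; split => //; first exact: segment_compact.
move=> x /= xab; apply: plateau_out => //; exact/negP.
Qed.

Lemma ler_dist_approx (A B x y G h : R) :
  `|A - x| <= h / 2 -> `|B - y| <= h / 2 -> `|A - B| <= G -> `|x - y| <= G + h.
Proof.
rewrite !ler_norml => /andP[? ?] /andP[? ?] /andP[? ?].
by apply/andP; split; lra.
Qed.

(** Take [plateau a b e] as test function. As [e] shrinks, the integral of [u] against its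
    derivative tends to [u a - u b], while the integral of [g] against it is bounded by that of
    [|g|], since the plateau has values of modulus at most 1 and support in []c, d[]. *)
Lemma weak_derivative_lt_osc Omega u g c d a b :
  weak_derivative Omega u g ->
  mu.-integrable Omega (EFin \o u) -> mu.-integrable Omega (EFin \o g) ->
  `]c, d[%classic `<=` Omega -> c < a -> a < b -> b < d ->
  lebesgue_pt (u \_ Omega) a -> lebesgue_pt (u \_ Omega) b ->
  `|u a - u b| <= \int[mu]_(x in `]c, d[) `|g x|.
Proof.
move=> [[_ oO _] _ hw] ui gi cdO ca ab bd pa pb.
have mO : measurable Omega by exact: open_measurable.
(* The extension by 0 is integrable on the whole line, where mollification takes place, and agrees
   with [u] on []c, d[]. *)
set f := u \_ Omega in pa pb.
have fi : mu.-integrable setT (EFin \o f).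
  apply: (@eq_integrable _ _ _ mu setT measurableT ((EFin \o u) \_ Omega) (EFin \o f)).
    by move=> x _; rewrite /f /= !patchE; case: ifP.
  exact: ((@integrable_mkcond _ _ _ mu Omega (EFin \o u) mO).1 ui).
have fE x : c < x -> x < d -> f x = u x.
  by move=> cx xd; rewrite /f patchE mem_set//; apply: cdO; rewrite /= in_itv/= cx.
rewrite -(fE a) ?(lt_trans ab)// -(fE b) ?(lt_trans ca)//.
apply/ler_addgt0Pr => eta eta0.
have eta20 : 0 < eta / 2 by rewrite divr_gt0.
near (0:R)^'+ => e.
have e0 : 0 < e by near: e; exact: nbhs_right_gt.
(* The support of the plateau reaches [b + e], which must remain below [d]. *)
have ebd : e < d - b by near: e; apply: nbhs_right_lt; rewrite subr_gt0.
have ha : `|\int[mu]_x (f x * mollifier a e x) - f a| <= eta / 2.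
  by near: e; exact: lebesgue_pt_mollify.
have hb : `|\int[mu]_x (f x * mollifier b e x) - f b| <= eta / 2.
  by near: e; exact: lebesgue_pt_mollify.
have KJ x : x \in `[a, b + e] -> x \in `]c, d[.
  by rewrite !in_itv/= => /andP[ax xb]; apply/andP; split; lra.
have tphi : test_function Omega (plateau a b e).
  apply: test_function_plateau => //; first exact: ltW.
  by apply: subset_trans cdO => x /= /KJ.
have uphi : \int[mu]_(x in Omega) (u x * ((plateau a b e)^`())%classic x) =
    \int[mu]_x (f x * mollifier a e x) - \int[mu]_x (f x * mollifier b e x).
  rewrite -RintegralB//; [|exact: integrable_mulr_mollifier..].
  rewrite Rintegral_mkcond derive1_plateau; apply: eq_Rintegral => x _.
  by rewrite /f !patchE; case: ifPn => _; rewrite ?mul0r ?subrr// mulrBr.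
have gphii : mu.-integrable Omega (fun x => (g x * plateau a b e x)%:E).
  apply: (@eq_integrable _ _ _ mu Omega mO ((EFin \o g) \* (EFin \o plateau a b e))%E) => //.
  apply: integrableMl => //.
    apply: (measurable_funS measurableT) => //; apply: continuous_measurable_fun.
    exact/flat_algebra_continuous/flat_algebra_plateau.
  exists 1; split; first exact: num_real.
  by move=> z /ltW z1 x _; exact: le_trans (plateau_le1 _ _ _ _) z1.
have gphi : `|\int[mu]_(x in Omega) (g x * plateau a b e x)| <= \int[mu]_(x in `]c, d[) `|g x|.
  apply: (le_trans (@le_normr_Rintegral _ _ _ mu Omega (fun x => g x * plateau a b e x) mO gphii)).
  have mJ : measurable `]c, d[%classic by exact: measurable_itv.
  have -> : \int[mu]_(x in `]c, d[) `|g x| =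
      \int[mu]_(x in Omega) ((fun x => `|g x|) \_ `]c, d[) x.
    by rewrite -Rintegral_mkcondr setIidr.
  apply: le_Rintegral => //.
  - exact: (@integrable_norm _ _ _ mu Omega (fun x => g x * plateau a b e x)).
  - rewrite -restrict_EFin; apply/integrable_restrict => //.
    have gJ : mu.-integrable `]c, d[ (EFin \o g) by exact: integrableS gi.
    by rewrite setIidr//; exact: (@integrable_norm _ _ _ mu _ g gJ).
  - move=> x _; rewrite patchE; case: ifPn => xJ.
      by rewrite normrM ler_piMr// plateau_le1.
    rewrite plateau_out ?mulr0 ?normr0 ?(ltW ab)//.
    by apply: contra xJ => /KJ xJ; rewrite inE.
move: (hw _ tphi) gphi; rewrite uphi => E.
rewrite -normrN -E; exact: ler_dist_approx ha hb.
Unshelve. all: by end_near. Qed.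

Lemma weak_derivative_osc Omega u g c d a b :
  weak_derivative Omega u g ->
  mu.-integrable Omega (EFin \o u) -> mu.-integrable Omega (EFin \o g) ->
  `]c, d[%classic `<=` Omega -> a \in `]c, d[ -> b \in `]c, d[ ->
  lebesgue_pt (u \_ Omega) a -> lebesgue_pt (u \_ Omega) b ->
  `|u a - u b| <= \int[mu]_(x in `]c, d[) `|g x|.
Proof.
rewrite !in_itv/= => ug ui gi cdO /andP[ca ad] /andP[cb bd] pa pb.
have [ab|ba|->] := ltgtP a b.
- exact: weak_derivative_lt_osc ug ui gi cdO ca ab bd pa pb.
- by rewrite distrC; exact: weak_derivative_lt_osc ug ui gi cdO cb ba ad pb pa.
- by rewrite subrr normr0; apply: Rintegral_ge0.
Qed.

End weak_derivative_oscillation.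

(** * Interval estimates *)

(** The optimisation in [l] and [t], detached from integration: [s] stands for [|u x|], [m] for the
    integral of [|u|], [D] for that of [g^2], and [h] for the length of the interval. *)
Lemma cube_le_of_scales {R : realFieldType} (s m D h : R) :
  0 <= s -> 0 <= m -> 0 <= D -> 0 < h ->
  (forall l t, 0 < l -> l < h -> 0 < t -> s <= m / l + (t * D + l / t) / 2) ->
  s ^+ 3 <= 8 * (m * D) + 8 * (m / h) ^+ 3.
Proof.
move=> s0 m0 D0 h0 H.
have mh0 : 0 <= m / h by rewrite divr_ge0// ltW.
have [sm|ms] := leP s (2 * (m / h)).
  have : s ^+ 3 <= (2 * (m / h)) ^+ 3 by rewrite lerXn2r// nnegrE mulr_ge0.
  have : 0 <= m * D by rewrite mulr_ge0.
  by rewrite exprMn => ? ?; lra.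
have {}s0 : 0 < s by rewrite (le_lt_trans _ ms)// mulr_ge0.
have [m00|{}m0] := leP m 0.
  (* For [m = 0] the choice [l = 2 m / s] degenerates. Here [t] and [l] are small enough that [t D]
     and [l / t] are both at most [s / 2]; then [s <= s / 2], a contradiction. *)
  have {m00 mh0 ms} m0 : m = 0 by apply/eqP; rewrite eq_le m00.
  pose t := s / (2 * (D + 1)).
  have t0 : 0 < t by rewrite divr_gt0// mulr_gt0// ltr_wpDl.
  pose l := Num.min (h / 2) (s * t / 2).
  have l0 : 0 < l by rewrite lt_min !divr_gt0// mulr_gt0.
  have lh : l < h by rewrite gt_min ltr_pdivrMr// ltr_pMr// ltr1n.
  have := H l t l0 lh t0; rewrite m0 mul0r add0r.
  have tD : t * D <= s / 2.
    rewrite /t -[leLHS]mulrA mulrC [leRHS]mulrC; apply: ler_wpM2r; first exact: ltW.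
    rewrite mulrC ler_pdivrMr ?mulr_gt0 ?ltr_wpDl//. lra.
  have lt : l / t <= s / 2.
    by rewrite ler_pdivrMr// mulrAC ge_min lexx orbT.
  by move=> ?; exfalso; lra.
(* l = 2 m / s makes m / l = s / 2, and t = 4 m / s^2 makes l / t = s / 2. *)
have l0 : 0 < 2 * m / s by rewrite divr_gt0// mulr_gt0.
have lh : 2 * m / s < h.
  by rewrite ltr_pdivrMr// [h * s]mulrC -ltr_pdivrMr// -mulrA.
have t0 : 0 < 4 * m / s ^+ 2 by rewrite divr_gt0 ?mulr_gt0// exprn_gt0.
have := H _ _ l0 lh t0.
have -> : m / (2 * m / s) = s / 2 by field; rewrite !gt_eqF.
have -> : 2 * m / s / (4 * m / s ^+ 2) = s / 2 by field; rewrite !gt_eqF.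
move=> hs.
(* The bound now reads [s <= s / 2 + 2 m D / s^2 + s / 4]; absorbing [3 s / 4] on the left produces
   the factor 8. *)
have : s <= 8 * (m * D) / s ^+ 2.
  have qE : 4 * m / s ^+ 2 * D = 4 * (m * D / s ^+ 2) by ring.
  by rewrite -mulrA; move: hs; rewrite qE; move: (m * D / s ^+ 2) => q; lra.
rewrite ler_pdivlMr ?exprn_gt0// -exprS => h3.
by rewrite ler_wpDr// mulr_ge0// exprn_ge0.
Qed.

Section interval_estimate.
Context {R : realType}.
Implicit Types (a b c d : R) (u g f : R -> R) (Omega : set R).
Local Notation mu := (@lebesgue_measure R).

Lemma ge0_subset_Rintegral f (A B : set R) : measurable A -> measurable B ->
  A `<=` B -> (forall x, 0 <= f x) -> mu.-integrable B (EFin \o f) ->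
  \int[mu]_(x in A) f x <= \int[mu]_(x in B) f x.
Proof.
move=> mA mB AB f0 fB; apply: fine_le.
- by apply: integrable_fin_num => //; exact: (@integrableS _ _ _ mu _ _ _ mB mA AB fB).
- by apply: integrable_fin_num.
apply: ge0_subset_integral => //; first by case/integrableP: fB.
by move=> x _; rewrite lee_fin.
Qed.

Lemma lebesgue_measure_itv_oo c d : c < d -> mu `]c, d[ = (d - c)%:E.
Proof. by move=> cd; rewrite lebesgue_measure_itv/= lte_fin cd. Qed.

Lemma Rintegral_cst_oo c d r : c < d -> \int[mu]_(x in `]c, d[) r = (d - c) * r.
Proof.
move=> cd; rewrite Rintegral_cst// mulrC; congr (_ * _).
by rewrite (_ : d - c = fine (d - c)%:E)//; congr fine; exact: lebesgue_measure_itv_oo.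
Qed.

(** Integrates the pointwise bound [|g| <= (t g^2 + 1 / t) / 2], which is [(t |g| - 1)^2 >= 0]
    divided by [2 t]. The parameter [t] stays free for a later optimisation. *)
Lemma Rintegral_norm_le_sqr g c d t : c < d -> 0 < t ->
  mu.-integrable `]c, d[ (EFin \o g) ->
  mu.-integrable `]c, d[ (fun x => (g x ^+ 2)%:E) ->
  \int[mu]_(x in `]c, d[) `|g x| <=
    (t * \int[mu]_(x in `]c, d[) (g x ^+ 2) + (d - c) / t) / 2.
Proof.
move=> cd t0 gi g2i.
have mJ : measurable `]c, d[%classic by exact: measurable_itv.
have Joo : (mu `]c, d[%classic < +oo)%E by rewrite lebesgue_measure_itv_oo// ltry.
have i1 := integrable_cst_fin _ (t^-1 / 2) mJ Joo.
have i2 : mu.-integrable `]c, d[ (EFin \o (fun x => t / 2 * g x ^+ 2)).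
  exact: (@integrableZl _ _ _ mu _ mJ (t / 2) _ g2i).
have -> : (t * \int[mu]_(x in `]c, d[) (g x ^+ 2) + (d - c) / t) / 2 =
   \int[mu]_(x in `]c, d[) (t / 2 * g x ^+ 2 + t^-1 / 2).
  rewrite RintegralD// RintegralZl// Rintegral_cst_oo//; field.
  by rewrite gt_eqF.
apply: le_Rintegral => //.
- exact: (@integrable_norm _ _ _ mu _ g gi).
- exact: (@integrableD _ _ _ mu _ mJ _ _ i2 i1).
move=> x _; have := sqr_ge0 (t * `|g x| - 1).
rewrite sqrrB1 exprMn real_normK ?num_real// => h.
rewrite -(ler_pM2l t0).
have -> : t * (t / 2 * g x ^+ 2 + t^-1 / 2) = (t ^+ 2 * g x ^+ 2 + 1) / 2.
  by field; rewrite gt_eqF.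
by move: h; lra.
Qed.

(** Integrate [|u x| <= |u y| + G] over [y] in the interval, [G] being the integral of [|g|]
    there. *)
Lemma weak_derivative_pointwise Omega u g c d x : c < d ->
  weak_derivative Omega u g ->
  mu.-integrable Omega (EFin \o u) -> mu.-integrable Omega (EFin \o g) ->
  `]c, d[%classic `<=` Omega -> x \in `]c, d[ -> lebesgue_pt (u \_ Omega) x ->
  (d - c) * `|u x| <=
    \int[mu]_(y in `]c, d[) `|u y| + (d - c) * \int[mu]_(y in `]c, d[) `|g y|.
Proof.
move=> cd ug ui gi cdO xJ px.
have mO : measurable Omega by case: ug => -[_ + _] _ _; exact: open_measurable.
have mJ : measurable `]c, d[%classic by exact: measurable_itv.
have Joo : (mu `]c, d[%classic < +oo)%E by rewrite lebesgue_measure_itv_oo// ltry.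
set G := \int[mu]_(y in `]c, d[) `|g y|.
have G0 : 0 <= G by apply: Rintegral_ge0.
have uJ : mu.-integrable `]c, d[ (EFin \o u) by exact: integrableS ui.
have nuJ := @integrable_norm _ _ _ mu _ u uJ.
have iG := integrable_cst_fin _ G mJ Joo.
have iu := integrable_cst_fin _ `|u x| mJ Joo.
have iuG := @integrableD _ _ _ mu _ mJ _ _ nuJ iG.
rewrite -!Rintegral_cst_oo// -RintegralD//.
apply: fine_le; [exact: integrable_fin_num|exact: integrable_fin_num|].
apply: ae_ge0_le_integral => //.
- by move=> y _; rewrite lee_fin addr_ge0.
- by case/integrableP: iuG.
have fi : mu.-integrable setT (EFin \o (u \_ Omega)).
  by rewrite -restrict_EFin; exact: ((@integrable_mkcond _ _ _ mu Omega (EFin \o u) mO).1 ui).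
(* The oscillation bound requires [y] to be a Lebesgue point, which holds for almost every [y]; that
   is enough under the integral. *)
have := lebesgue_differentiation (open_integrable_locally openT fi).
apply: filter_app; first exact: (ae_filter_ringOfSetsType mu).
apply: aeW => y py yJ.
rewrite lee_fin -lerBlDl (le_trans (lerB_dist _ _))//.
exact: weak_derivative_osc ug ui gi cdO xJ yJ px py.
Qed.


Lemma weak_derivative_cube Omega u g a b x : a < b ->
  weak_derivative Omega u g ->
  mu.-integrable Omega (EFin \o u) -> mu.-integrable Omega (EFin \o g) ->
  mu.-integrable Omega (fun x => (g x ^+ 2)%:E) ->
  `]a, b[%classic `<=` Omega -> x \in `]a, b[ -> lebesgue_pt (u \_ Omega) x ->
  `|u x| ^+ 3 <=
    8 * ((\int[mu]_(y in `]a, b[) `|u y|) * \int[mu]_(y in `]a, b[) (g y ^+ 2)) +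
    8 * ((\int[mu]_(y in `]a, b[) `|u y|) / (b - a)) ^+ 3.
Proof.
move=> ab ug ui gi g2i abO xI px; set m := \int[mu]_(y in _) `|u y|.
have mO : measurable Omega by case: ug => -[_ + _] _ _; exact: open_measurable.
have mI : measurable `]a, b[%classic by exact: measurable_itv.
have uI := @integrableS _ _ _ mu _ _ _ mO mI abO ui.
have g2I := @integrableS _ _ _ mu _ _ _ mO mI abO g2i.
have ba0 : 0 < b - a by rewrite subr_gt0.
move: (xI); rewrite in_itv/= => /andP[ax xb].
apply: cube_le_of_scales => //.
- exact: Rintegral_ge0.
- by apply: Rintegral_ge0 => y _; exact: sqr_ge0.
move=> l t l0 lba t0.
(* The subinterval of length l that divides (a, b) around x in the ratio (x - a) : (b - x). *)
pose c := x - l * ((x - a) / (b - a)).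
have r0 : 0 < (x - a) / (b - a) by rewrite divr_gt0// subr_gt0.
have r1 : (x - a) / (b - a) < 1 by rewrite ltr_pdivrMr// mul1r ltrD2r.
have rE : (x - a) / (b - a) * (b - a) = x - a by rewrite divfK// gt_eqF.
have ac : a <= c.
  rewrite /c lerBrDr -lerBrDl -[leRHS]rE mulrC ler_pM2l//; exact: ltW.
have cx : c < x by rewrite /c gtrBl mulr_gt0.
have xc : x < c + l.
  by rewrite /c -addrA ltrDl addrC subr_gt0 gtr_pMr.
have cb : c + l <= b.
  rewrite /c -subr_ge0.
  (* With [r = (x - a) / (b - a)], the room left on the right is the fraction [1 - r] of
     [b - a - l]. *)
  have -> : b - (x - l * ((x - a) / (b - a)) + l) =
    (1 - (x - a) / (b - a)) * (b - a - l).
    by rewrite [RHS]mulrBr [(1 - _) * (b - a)]mulrBl mul1r rE; ring.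
  by rewrite mulr_ge0// subr_ge0 ltW.
have cd : c < c + l by rewrite ltrDl.
have JI : `]c, c + l[%classic `<=` `]a, b[%classic.
  move=> y /=; rewrite !in_itv/= => /andP[cy yd].
  by rewrite (le_lt_trans ac cy) (lt_le_trans yd cb).
have mJ : measurable `]c, c + l[%classic by exact: measurable_itv.
have JO := subset_trans JI abO.
have xJ : x \in `]c, c + l[ by rewrite in_itv/= cx.
have := weak_derivative_pointwise _ _ _ _ _ _ cd ug ui gi JO xJ px.
have lE : c + l - c = l by rewrite addrC addKr.
have gJ := @integrableS _ _ _ mu _ _ _ mO mJ JO gi.
have g2J := @integrableS _ _ _ mu _ _ _ mO mJ JO g2i.
have := Rintegral_norm_le_sqr g c (c + l) t cd t0 gJ g2J.
rewrite lE => hg hu.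
have hm : \int[mu]_(y in `]c, c + l[) `|u y| <= m.
  apply: ge0_subset_Rintegral => //.
  exact: (@integrable_norm _ _ _ mu _ u uI).
have hD : \int[mu]_(y in `]c, c + l[) (g y ^+ 2) <= \int[mu]_(y in `]a, b[) (g y ^+ 2).
  by apply: ge0_subset_Rintegral => // y; exact: sqr_ge0.
have {}hu : `|u x| <= (\int[mu]_(y in `]c, c + l[) `|u y|) / l +
    \int[mu]_(y in `]c, c + l[) `|g y|.
  by rewrite -(ler_pM2l l0) mulrDr [l * (_ / l)]mulrC divfK// gt_eqF.
apply: (le_trans hu); apply: lerD.
  by rewrite ler_pM2r// invr_gt0.
apply: (le_trans hg); rewrite ler_pM2r ?invr_gt0// lerD2r.
by rewrite ler_pM2l.
Qed.

(** The pointwise bound [S] on [|u|^3], valid at almost every point, is multiplied by [|u|] and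
    integrated, which gives [S m]. The left side is an extended integral, so its finiteness is part
    of the conclusion. *)
Lemma weak_derivative_int_pow4 Omega u g a b : a < b ->
  weak_derivative Omega u g ->
  mu.-integrable Omega (EFin \o u) -> mu.-integrable Omega (EFin \o g) ->
  mu.-integrable Omega (fun x => (g x ^+ 2)%:E) ->
  `]a, b[%classic `<=` Omega ->
  (\int[mu]_(x in `]a, b[) (`|u x| ^+ 4)%:E <=
    (8 * ((\int[mu]_(y in `]a, b[) `|u y|) ^+ 2 *
          \int[mu]_(y in `]a, b[) (g y ^+ 2))%R +
     8 * ((\int[mu]_(y in `]a, b[) `|u y|) ^+ 4 / (b - a) ^+ 3))%:E)%E.
Proof.
move=> ab ug ui gi g2i abO; set m := (\int[mu]_(y in _) `|u y|)%R.
have mO : measurable Omega by case: ug => -[_ + _] _ _; exact: open_measurable.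
have mI : measurable `]a, b[%classic by exact: measurable_itv.
have uI := @integrableS _ _ _ mu _ _ _ mO mI abO ui.
have nuI := @integrable_norm _ _ _ mu _ u uI.
set S := 8 * (m * \int[mu]_(y in `]a, b[) (g y ^+ 2)) + 8 * (m / (b - a)) ^+ 3.
have m0 : 0 <= m by apply: Rintegral_ge0.
have S0 : 0 <= S.
  rewrite addr_ge0// mulr_ge0//; last by rewrite exprn_ge0// divr_ge0// subr_ge0 ltW.
  by rewrite mulr_ge0//; apply: Rintegral_ge0 => y _; exact: sqr_ge0.
have -> : 8 * (m ^+ 2 * \int[mu]_(y in `]a, b[) (g y ^+ 2)) +
     8 * (m ^+ 4 / (b - a) ^+ 3) = S * m.
  by rewrite /S; field; rewrite gt_eqF// subr_gt0.
have -> : ((S * m)%:E = \int[mu]_(x in `]a, b[) (S * `|u x|)%:E)%E.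
  rewrite EFinM /m /Rintegral fineK; last exact: (@integrable_fin_num _ _ _ mu _ mI _ nuI).
  rewrite -ge0_integralZl//; last by case/integrableP: nuI.
have mu4 : measurable_fun `]a, b[ u by case/integrableP: uI => /measurable_EFinP.
have fi : mu.-integrable setT (EFin \o (u \_ Omega)).
  by rewrite -restrict_EFin; exact: ((@integrable_mkcond _ _ _ mu Omega (EFin \o u) mO).1 ui).
apply: ae_ge0_le_integral => //.
- apply/measurable_EFinP; apply: measurable_funX; exact: measurableT_comp.
- by move=> x _; rewrite lee_fin mulr_ge0.
- apply/measurable_EFinP; apply: measurable_funM => //; exact: measurableT_comp.
have := lebesgue_differentiation (open_integrable_locally openT fi).
apply: filter_app; first exact: (ae_filter_ringOfSetsType mu).
apply: aeW => x px xI; rewrite lee_fin exprSr ler_wpM2r//.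
exact: (weak_derivative_cube _ _ _ _ _ _ ab ug ui gi g2i abO xI px).
Qed.

End interval_estimate.

(** * Summation over a partition into equal intervals *)

Section partition_of_interval.
Context {R : realType}.
Local Notation mu := (@lebesgue_measure R).

Lemma ge0_integral_oo_partition (F : R -> \bar R) (h : R) n : 0 < h ->
  measurable_fun `]0, n%:R * h[ F -> (forall x, (0 <= F x)%E) ->
  (\int[mu]_(x in `]0%R, (n%:R * h)%R[) F x =
   \sum_(k < n) \int[mu]_(x in `](k%:R * h)%R, (k.+1%:R * h)%R[) F x)%E.
Proof.
move=> h0 + F0; elim: n => [|n ih] mF.
  by rewrite big_ord0 mul0r set_itvoo0 integral_set0.
have nn1 : n%:R * h <= n.+1%:R * h by rewrite ler_pM2r// ler_nat.
have nh0 : 0 <= n%:R * h by rewrite mulr_ge0// ltW.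
have mFn : measurable_fun `]0, n%:R * h[ F.
  apply: measurable_funS mF => //.
  move=> x /=; rewrite !in_itv/= => /andP[-> xn] /=; exact: lt_le_trans nn1.
(* The node [n h] is put into the left piece and then dropped, being a null set. *)
have E : `]0, n.+1%:R * h[%classic =
   `]0, n%:R * h] `|` `]n%:R * h, n.+1%:R * h[ :> set R.
  by apply: itv_bndbnd_setU; rewrite bnd_simp// ltr_pM2r// ltr_nat.
rewrite big_ord_recr/= -ih// E ge0_integral_setU//.
- by rewrite integral_itv_bndoo.
- by rewrite -E.
- apply/disj_setPS => x [] /=; rewrite !in_itv/= => /andP[_ xn] /andP[nx _].
  by move: (lt_le_trans nx xn); rewrite ltxx.
Qed.

(** In the first term the squared mass of each piece is at most [B^2] and the integrals of [g^2] add
    up; in the second each mass is at most the total one, whence the factor [n]. [B] is kept general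
    because it is the Morrey bound or the total mass, according to whether the Morrey norm is
    finite. *)
Lemma weak_derivative_int_pow4_partition (u g : R -> R) (h B : R) n : 0 < h ->
  let Omega := `]0, n%:R * h[%classic in
  weak_derivative Omega u g ->
  mu.-integrable Omega (EFin \o u) -> mu.-integrable Omega (EFin \o g) ->
  mu.-integrable Omega (fun x => (g x ^+ 2)%:E) ->
  (forall k, (k < n)%N ->
     \int[mu]_(y in `](k%:R * h), (k.+1%:R * h)[) `|u y| <= B) ->
  (\int[mu]_(x in Omega) (`|u x| ^+ 4)%:E <=
    (8 * (B ^+ 2 * \int[mu]_(y in Omega) (g y ^+ 2))%R +
     8 * n%:R / h ^+ 3 * (\int[mu]_(y in Omega) `|u y|) ^+ 4)%:E)%E.
Proof.
move=> h0 Omega ug ui gi g2i hB.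
have mO : measurable Omega by exact: measurable_itv.
have mu0 : measurable_fun Omega u by case/integrableP: ui => /measurable_EFinP.
have mg0 : measurable_fun Omega g by case/integrableP: gi => /measurable_EFinP.
have mg2 : measurable_fun Omega (EFin \o (fun x => g x ^+ 2)).
  by apply/measurable_EFinP; exact: measurable_funX.
have mu4 : measurable_fun Omega (EFin \o (fun x => `|u x| ^+ 4)).
  by apply/measurable_EFinP; apply: measurable_funX; exact: measurableT_comp.
pose D k := \int[mu]_(y in `](k%:R * h), (k.+1%:R * h)[) (g y ^+ 2).
set m := (\int[mu]_(y in Omega) `|u y|)%R.
have JO k : (k < n)%N -> `](k%:R * h), (k.+1%:R * h)[%classic `<=` Omega.
  move=> kn x; rewrite /Omega /= !in_itv/= => /andP[kx xk].
  rewrite (le_lt_trans _ kx) ?mulr_ge0// ?ltW//=.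
  by rewrite (lt_le_trans xk)// ler_pM2r// ler_nat.
have mJ k : measurable `](k%:R * h), (k.+1%:R * h)[%classic by exact: measurable_itv.
have DE : \sum_(k < n) D k = \int[mu]_(y in Omega) (g y ^+ 2).
  apply: EFin_inj; rewrite -sumEFin /Rintegral fineK; last first.
    exact: (@integrable_fin_num _ _ _ mu _ mO).
  rewrite /Omega ge0_integral_oo_partition//.
  - apply: eq_bigr => k _; rewrite fineK//.
    apply: (@integrable_fin_num _ _ _ mu _ (mJ k)).
    exact: (@integrableS _ _ _ mu _ _ _ mO (mJ k) (JO k (ltn_ord k)) g2i).
  - by move=> x; rewrite lee_fin sqr_ge0.
rewrite /Omega ge0_integral_oo_partition//.
have hE k : k.+1%:R * h - k%:R * h = h by rewrite -mulrBl -natrB// subSnn mul1r.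
have -> : 8 * (B ^+ 2 * \int[mu]_(y in Omega) (g y ^+ 2)) +
     8 * n%:R / h ^+ 3 * m ^+ 4 =
   \sum_(k < n) (8 * (B ^+ 2 * D k) + 8 * (m ^+ 4 / h ^+ 3)).
  rewrite big_split/= -!mulr_sumr DE sumr_const card_ord -mulr_natr.
  by congr (_ + _); ring.
rewrite -sumEFin; apply: lee_sum => k _.
have kh : k%:R * h < k.+1%:R * h by rewrite -subr_gt0 hE.
have := weak_derivative_int_pow4 _ _ _ _ _ kh ug ui gi g2i (JO _ (ltn_ord k)).
move=> /le_trans; apply; rewrite hE lee_fin lerD//.
  rewrite ler_pM2l// ler_wpM2r//.
    by apply: Rintegral_ge0 => y _; exact: sqr_ge0.
  rewrite ler_sqr ?nnegrE ?hB// ?Rintegral_ge0//.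
  by apply: le_trans (hB _ (ltn_ord k)); exact: Rintegral_ge0.
rewrite ler_pM2l// ler_pM2r ?invr_gt0 ?exprn_gt0//.
apply: lerXn2r; rewrite ?nnegrE ?Rintegral_ge0//.
apply: ge0_subset_Rintegral => //; first exact: JO.
exact: (@integrable_norm _ _ _ mu _ u ui).
Qed.

End partition_of_interval.

(** * The norms of order 1 and 2 as integrals *)

Section norms.
Context {R : realType}.
Local Notation mu := (@lebesgue_measure R).
Implicit Types (A : set R) (u : R -> R).

Lemma Lnorm_on1E A u : measurable A ->
  Lnorm_on 1 A u = (\int[mu]_(x in A) `|u x|%:E)%E.
Proof.
move=> mA; rewrite /Lnorm_on Lnorm1 [RHS]integral_mkcond.
by apply: eq_integral => x _; rewrite /= !patchE; case: ifP => //=; rewrite normr0.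
Qed.

Lemma Lnorm_on2E A u : measurable A ->
  (Lnorm_on 2 A u ^+ 2 = \int[mu]_(x in A) (u x ^+ 2)%:E)%E.
Proof.
move=> mA; rewrite /Lnorm_on unlock poweR12_sqrt; last first.
  by apply: integral_ge0 => x _; exact: poweR_ge0.
rewrite sqr_sqrte; last by apply: integral_ge0 => x _; exact: poweR_ge0.
rewrite [RHS]integral_mkcond; apply: eq_integral => x _ /=.
rewrite !patchE; case: ifP => _ /=.
  by rewrite powR_mulrn// real_normK ?num_real.
by rewrite normr0 powR0// pnatr_eq0.
Qed.

Lemma Lnorm_on2_fin A u : measurable A -> measurable_fun A u ->
  (Lnorm_on 2 A u < +oo)%E -> mu.-integrable A (fun x => (u x ^+ 2)%:E).
Proof.
move=> mA mu_ uoo; apply/integrableP; split.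
  by apply/measurable_EFinP; exact: measurable_funX.
under eq_integral do rewrite gee0_abs ?lee_fin ?sqr_ge0//.
by rewrite -Lnorm_on2E// expe2 lte_mul_pinfty ?Lnorm_ge0// ge0_fin_numE ?Lnorm_ge0.
Qed.

(** On a set of finite measure [u^2 + 1] is integrable, and it dominates [|u|]. *)
Lemma integrable_of_sqr A u : measurable A -> (mu A < +oo)%E ->
  measurable_fun A u -> mu.-integrable A (fun x => (u x ^+ 2)%:E) ->
  mu.-integrable A (EFin \o u).
Proof.
move=> mA Aoo mu_ u2.
have i1 := integrable_cst_fin _ 1 mA Aoo.
have := @integrableD _ _ _ mu _ mA _ _ u2 i1.
apply: le_integrable => //; first exact/measurable_EFinP.
move=> x _ /=; rewrite lee_fin [leRHS]ger0_norm ?addr_ge0 ?sqr_ge0//.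
rewrite -real_normK ?num_real//; have := sqr_ge0 (`|u x| - 1).
by rewrite sqrrB1; have := normr_ge0 (u x); lra.
Qed.

End norms.

(** * The Morrey norm *)

Section morrey.
Context {R : realType}.
Local Notation mu := (@lebesgue_measure R).
Implicit Types (L delta a b : R) (u g : R -> R).

Lemma morrey_norm_ge L delta u e x0 : e \in `]0, L[ -> x0 \in `]0, L[ ->
  ((e `^ (- delta))%:E * Lnorm_on 1 (`[(x0 - e)%R, (x0 + e)%R] `&` `]0%R, L[) u
    <= morrey_norm L delta u)%E.
Proof.
move=> e0L x0L; rewrite /morrey_norm.
apply: le_trans; last by apply: ereal_sup_ubound; exists e; first exact: e0L.
by apply: ereal_sup_ubound; exists x0; first exact: x0L.
Qed.

(** The supremum of an empty set would be [-oo]; since [0 < L], the radius and centre [L / 2] are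
    admissible and give a nonnegative lower bound. *)
Lemma morrey_norm_ge0 L delta u : 0 < L -> (0 <= morrey_norm L delta u)%E.
Proof.
move=> L0; have L2 : L / 2 \in `]0, L[.
  by rewrite in_itv/= divr_gt0//= ltr_pdivrMr// ltr_pMr// ltr1n.
apply: le_trans (morrey_norm_ge L delta u (L / 2) (L / 2) L2 L2).
by rewrite mule_ge0 ?Lnorm_ge0// lee_fin powR_ge0.
Qed.

Lemma integral_le_morrey L delta u a b : 0 <= a -> a < b -> b <= L ->
  measurable_fun `]0, L[ u ->
  (\int[mu]_(x in `]a, b[) `|u x|%:E <=
    (((b - a) / 2) `^ delta)%:E * morrey_norm L delta u)%E.
Proof.
move=> a0 ab bL mu_.
(* Midpoint and half-length of []a, b[]; the half-length is at most [L / 2], hence an admissible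
   radius. *)
pose e := (b - a) / 2; pose x0 := (a + b) / 2.
have e0 : 0 < e by rewrite /e divr_gt0// subr_gt0.
have eL : e \in `]0, L[ by rewrite in_itv/= e0/= /e; lra.
have x0L : x0 \in `]0, L[ by rewrite in_itv/= /x0; apply/andP; split; lra.
have h := morrey_norm_ge L delta u e x0 eL x0L.
set A := `[_, _] `&` _ in h.
have mA : measurable A by apply: measurableI; exact: measurable_itv.
rewrite Lnorm_on1E// in h.
have p0 : 0 < e `^ delta by rewrite powR_gt0.
apply: (@le_trans _ _ (\int[mu]_(x in A) `|u x|%:E)%E).
  apply: ge0_subset_integral => //.
    apply/measurable_EFinP.
    have muA : measurable_fun A u.
      by apply: (measurable_funS _ (@subIsetr _ _ _)); [exact: measurable_itv|exact: mu_].
    exact: measurableT_comp.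
  move=> x /=; rewrite in_itv/= => /andP[ax xb]; split; rewrite /= in_itv/=.
    by rewrite /x0 /e; apply/andP; split; lra.
  by rewrite (le_lt_trans a0 ax) (lt_le_trans xb bL).
have : (\int[mu]_(x in A) `|u x|%:E)%E =
   ((e `^ delta)%:E * ((e `^ (- delta))%:E * \int[mu]_(x in A) `|u x|%:E))%E.
  by rewrite muleA -EFinM powRN divff ?mul1e// gt_eqF.
by move=> ->; rewrite lee_pmul2l.
Qed.

(** For a finite Morrey norm [M], each piece of length [h = L / n] has mass at most
    [B = (h / 2)^delta M], and the condition on [n] says exactly that
    [8 (h / 2)^(2 delta) <= eps]. *)
Lemma int_pow4_le_morrey L delta eps n u g : 0 < L -> 0 < eps -> (0 < n)%N ->
  8 * ((L / n%:R / 2) `^ delta) ^+ 2 <= eps ->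
  L2 `]0, L[%classic u -> weak_derivative `]0, L[%classic u g ->
  L2 `]0, L[%classic g ->
  (\int[mu]_(x in `]0%R, L[) (`|u x| ^+ 4)%:E
      <= eps%:E * morrey_norm L delta u ^+ 2 * Lnorm_on 2 `]0%R, L[%classic g ^+ 2
         + (8 * n%:R / (L / n%:R) ^+ 3)%:E * Lnorm_on 1 `]0%R, L[%classic u ^+ 4)%E.
Proof.
move=> L0 eps0 n0 hn [mu_ u2] ug [mg g2].
have n0R : 0 < n%:R :> R by rewrite ltr0n.
set h := L / n%:R in hn *.
have h0 : 0 < h by rewrite divr_gt0.
have Lh : n%:R * h = L by rewrite /h mulrC divfK// gt_eqF.
have mO : measurable `]0, L[%classic by exact: measurable_itv.
have Ooo : (mu `]0%R, L[%classic < +oo)%E by rewrite lebesgue_measure_itv_oo// ltry.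
have u2i := Lnorm_on2_fin _ _ mO mu_ u2.
have g2i := Lnorm_on2_fin _ _ mO mg g2.
have ui := integrable_of_sqr _ _ mO Ooo mu_ u2i.
have gi := integrable_of_sqr _ _ mO Ooo mg g2i.
have nui := @integrable_norm _ _ _ mu _ u ui.
pose m := (\int[mu]_(x in `]0%R, L[) `|u x|)%R.
pose D := (\int[mu]_(x in `]0%R, L[) (g x ^+ 2))%R.
have D0 : 0 <= D by apply: Rintegral_ge0 => x _; exact: sqr_ge0.
have mE : Lnorm_on 1 `]0%R, L[%classic u = m%:E.
  by rewrite Lnorm_on1E// /m /Rintegral fineK// (@integrable_fin_num _ _ _ mu _ mO _ nui).
have DE : (Lnorm_on 2 `]0%R, L[%classic g ^+ 2 = D%:E)%E.
  by rewrite Lnorm_on2E// /D /Rintegral fineK// (@integrable_fin_num _ _ _ mu _ mO _ g2i).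
rewrite mE DE -EFin_expe -EFinM.
have key (B : R) := @weak_derivative_int_pow4_partition _ u g h B n h0.
rewrite /= Lh in key; have {}key B := key B ug ui gi g2i.
have JL k : (k < n)%N -> k.+1%:R * h <= L by move=> kn; rewrite -Lh ler_pM2r// ler_nat.
have kh k : k%:R * h < k.+1%:R * h by rewrite ltr_pM2r// ltr_nat.
have kh0 k : 0 <= k%:R * h by rewrite mulr_ge0// ltW.
have mJ k : measurable `](k%:R * h), (k.+1%:R * h)[%classic by exact: measurable_itv.
have JO k : (k < n)%N -> `](k%:R * h), (k.+1%:R * h)[%classic `<=` `]0, L[%classic.
  move=> kn x; rewrite /= !in_itv/= => /andP[kx xk].
  by rewrite (le_lt_trans _ kx)//= (lt_le_trans xk (JL _ kn)).
have hm k : (k < n)%N -> \int[mu]_(y in `](k%:R * h), (k.+1%:R * h)[) `|u y| <= m.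
  by move=> kn; apply: ge0_subset_Rintegral => //; exact: JO.
have := morrey_norm_ge0 L delta u L0.
case ME : (morrey_norm L delta u) => [M| |]//; last first.
  (* For an infinite Morrey norm, the right side is [+oo] unless [D = 0]. In that case [+oo * 0 = 0]
     removes its first term, and the partition bound with [B = m] loses its first term as well. *)
  move=> _; have [D00|Dn0] := eqVneq D 0.
    rewrite D00 mule0 add0e; apply: (le_trans (key m hm)).
    by rewrite -/D D00 mulr0 mulr0 add0r.
  rewrite expe2 mulyy gt0_muley ?lte_fin// gt0_mulye ?lte_fin ?lt0r ?Dn0//.
  by rewrite addye// leey.
rewrite lee_fin => M0.
have hB k : (k < n)%N ->
    \int[mu]_(y in `](k%:R * h), (k.+1%:R * h)[) `|u y| <= (h / 2) `^ delta * M.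
  move=> kn.
  have nuJ := @integrableS _ _ _ mu _ _ _ mO (mJ k) (JO k kn) nui.
  rewrite -lee_fin /Rintegral fineK ?(@integrable_fin_num _ _ _ mu _ (mJ k) _ nuJ)//.
  have := integral_le_morrey L delta u _ _ (kh0 k) (kh k) (JL k kn) mu_.
  by rewrite ME -mulrBl -natrB// subSnn mul1r.
apply: (le_trans (key _ hB)).
rewrite -EFin_expe -!EFinM -EFinD lee_fin lerD2r -/D.
rewrite exprMn -[_ * M ^+ 2 * D]mulrA mulrA -[eps * _ * D]mulrA.
by apply: ler_wpM2r => //; rewrite mulr_ge0// sqr_ge0.
Qed.

Lemma exists_fine_partition L delta eps : 0 < L -> 0 < delta -> 0 < eps ->
  exists2 n, (0 < n)%N & 8 * ((L / n%:R / 2) `^ delta) ^+ 2 <= eps.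
Proof.
move=> L0 d0 eps0.
(* [q] solves [8 (q^delta)^2 = eps], so it suffices that [L / n / 2 <= q]; the Archimedean property
   supplies [n > L / (2 q)]. *)
pose q := (eps / 8) `^ (2^-1 / delta).
have q0 : 0 < q by rewrite powR_gt0// divr_gt0.
have Lq0 : 0 < L / (2 * q) by rewrite divr_gt0// mulr_gt0.
have hb := archi_boundP (ltW Lq0).
exists (Num.bound (L / (2 * q))); first by rewrite -(ltr0n R) (lt_trans Lq0).
set N := (Num.bound _)%:R in hb *; have N0 : 0 < N := lt_trans Lq0 hb.
have Lq : L / N / 2 <= q.
  move: hb; rewrite ltr_pdivrMr ?mulr_gt0// => hb.
  by rewrite ler_pdivrMr// ler_pdivrMr//; move: (ltW hb); lra.
have h : (L / N / 2) `^ delta <= Num.sqrt (eps / 8).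
  rewrite -powR12_sqrt ?divr_ge0 ?(ltW eps0)//.
  have -> : (eps / 8) `^ 2^-1 = q `^ delta by rewrite /q -powRrM divfK// gt_eqF.
  by apply: ge0_ler_powR; rewrite ?(ltW d0)// nnegrE ?(ltW q0)// !divr_ge0// ltW.
have := lerXn2r 2 (powR_ge0 _ _) (sqrtr_ge0 _) h.
by rewrite sqr_sqrtr ?divr_ge0 ?(ltW eps0)// ler_pdivlMr// mulrC.
Qed.

End morrey.

Theorem proposition3p5 (R : realType) (L delta : R) (hL : 0 < L)
    (hdelta : 0 < delta) (eps : R) (heps : 0 < eps) :
  exists C : R, 0 < C /\
    forall u : R -> R, H1 `]0, L[%classic u ->
    forall du : R -> R, weak_derivative `]0, L[%classic u du ->
    (\int[@lebesgue_measure R]_(x in `]0%R, L[) (`|u x| ^+ 4)%:E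
      <= eps%:E * morrey_norm L delta u ^+ 2
           * Lnorm_on 2 `]0%R, L[%classic du ^+ 2
         + C%:E * Lnorm_on 1 `]0%R, L[%classic u ^+ 4)%E.
Proof.
have [n n0 hn] := exists_fine_partition L delta eps hL hdelta heps.
have C0 : 0 < 8 * n%:R / (L / n%:R) ^+ 3.
  by rewrite divr_gt0 ?exprn_gt0 ?divr_gt0 ?mulr_gt0 ?ltr0n.
exists (8 * n%:R / (L / n%:R) ^+ 3); split=> //.
move=> u [u2 [g [ug g2]]] du udu.
(* [du] is an arbitrary weak derivative, possibly other than the witness [g] from [H1]. If its norm
   is finite it is itself in [L2], local integrability providing measurability. *)
have [duoo|] := ltP (Lnorm_on 2 `]0, L[%classic du) +oo%E.
  by apply: (int_pow4_le_morrey L delta eps n u du) => //; split=> //; case: udu => _ [].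
(* Here the bound is trivial unless the Morrey norm vanishes: then 0 * +oo = 0,
   and the square-integrable weak derivative g takes the place of du. *)
rewrite leye_eq => /eqP ->.
have [M0|Mn0] := eqVneq (morrey_norm L delta u) 0%E.
  have := int_pow4_le_morrey L delta eps n u g hL heps n0 hn u2 ug g2.
  by rewrite M0 expe2 mule0 mule0 !mul0e.
(* With a positive Morrey norm, the infinite norm of [du] makes the right side [+oo]. *)
have Mgt0 : (0 < morrey_norm L delta u)%E by rewrite lt0e Mn0 morrey_norm_ge0.
rewrite [(+oo ^+ 2)%E]expe2 mulyy gt0_muley; last first.
  by rewrite mule_gt0 ?lte_fin// expe_gt0.
rewrite addye ?leey// gt_eqF// (lt_le_trans ltNy0)// mule_ge0 ?lee_fin//.
  by rewrite ltW.
by rewrite expe_ge0// Lnorm_ge0.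
Qed.
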